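(* Let $(\mathcal C,p)$ and $(\mathcal C',p')$, with universes $p:\widetilde U\to U$ and $p':\widetilde U'\to U'$, be universe categories each equipped with a locally cartesian closed structure and a binary product structure, and let ${\bf\Phi}=(\Phi,\phi,\widetilde\phi):(\mathcal C,p)\to(\mathcal C',p')$ be a universe category functor (no compatibility of $\Phi$ with the locally cartesian closed or binary product structures is assumed). Let $\Gamma\in Ob(CC(\mathcal C,p))$ and $n\ge1$. Then: 1. for $T\in\mathcal{O}b_n(\Gamma)$, $$\mu_{n,H(\Gamma)}(H(T))=\psi(\Gamma)\circ\Phi(\mu_{n,\Gamma}(T))\circ\xi_{{\bf\Phi},n-1};$$ 2. for $o\in\widetilde{\mathcal{O}b}_n(\Gamma)$, $$\widetilde\mu_{n,H(\Gamma)}(H(o))=\psi(\Gamma)\circ\Phi(\widetilde\mu_{n,\Gamma}(o))\circ\widetilde\xi_{{\bf\Phi},n-1}.$$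
   Context: Conventions. Composition is written in diagrammatic order: for $f:X\to Y$, $g:Y\to Z$ the composite is $f\circ g:X\to Z$. $\amalg_{i\in I}A_i$ denotes the set of pairs $(i,a)$, $i\in I$, $a\in A_i$. For a morphism $p:Y\to X$, $sec(p)=\{s:X\to Y\mid s\circ p=Id_X\}$. All constructions below for $(\mathcal C,p)$ are applied also to $(\mathcal C',p')$. Universes. A universe in a category $\mathcal C$ is a morphism $p:\widetilde U\to U$ with a choice, for every $F:X\to U$, of a pullback square with vertex $(X;F)$ and projections $p_F:(X;F)\to X$, $Q(F):(X;F)\to\widetilde U$, $p_F\circ F=Q(F)\circ p$. For $f:X'\to X$ and $F:X\to U$, $Q(f,F):(X';f\circ F)\to(X;F)$ is the unique morphism with $Q(f,F)\circ p_F=p_{f\circ F}\circ f$ and $Q(f,F)\circ Q(F)=Q(f\circ F)$. A universe category $(\mathcal C,p)$ is a category with a universe $p$ and a chosen final object $pt$. Sets $D_p^n(X,Y)$. $D_p^0(X,Y)=Mor_{\mathcal C}(X,Y)$ and $D_p^{n}(X,Y)=\amalg_{F:X\to U}D_p^{n-1}((X;F),Y)$ for $n\ge1$. For $d\in D_p^n(X,Y)$, $f:X'\to X$, $g:Y\to Y'$, elements $f\circ d\in D_p^n(X',Y)$ and $d\circ g\in D_p^n(X,Y')$ are given by composition in $\mathcal C$ for $n=0$ and, for $n\ge1$, by $f\circ(F,a)=(f\circ F,Q(f,F)\circ a)$, $(F,a)\circ g=(F,a\circ g)$. The C-system $CC(\mathcal C,p)$. Define recursively sets $Ob_n(\mathcal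 C,p)$ and functions $int:Ob_n(\mathcal C,p)\to Ob(\mathcal C)$: $Ob_0(\mathcal C,p)=\{tt\}$, $int(tt)=pt$; $Ob_{n+1}(\mathcal C,p)=\amalg_{A\in Ob_n(\mathcal C,p)}Mor_{\mathcal C}(int(A),U)$, $int(A,F)=(int(A);F)$. Objects of $CC(\mathcal C,p)$ are pairs $\Gamma=(n,A)$ with $A\in Ob_n(\mathcal C,p)$, and $int(\Gamma)=int(A)$. Morphisms $\Gamma'\to\Gamma$ are (copies of) the morphisms $int(\Gamma')\to int(\Gamma)$ of $\mathcal C$, so that $int:CC(\mathcal C,p)\to\mathcal C$ is a fully faithful functor. Set $l(n,A)=n$, $ft(n+1,(A,F))=(n,A)$, $ft(0,tt)=(0,tt)$; for $T=(n+1,(A,F))$, $p_T:T\to ft(T)$ is the morphism with $int(p_T)=p_F$. For $n\ge 0$, $\mathcal{O}b_n(\Gamma)=\{T\mid l(T)=l(\Gamma)+n,\ ft^n(T)=\Gamma\}$. For $n\ge1$, $\widetilde{\mathcal{O}b}_n(\Gamma)$ is the set of morphisms $o$ with $\partial(o):=codom(o)\in\mathcal{O}b_n(\Gamma)$ and $o\in sec(p_{\partial(o)})$. Bijections $u_{n,\Gamma}:\mathcal{O}b_n(\Gamma)\to D_p^{n-1}(int(\Gamma),U)$ and $\widetilde u_{n,\Gamma}:\widetilde{\mathcal{O}b}_n(\Gamma)\to D_p^{n-1}(int(\Gamma),\widetilde U)$, $n\ge1$: for $\Gamma=(n,A)$ and $T=(n+1,(A,F))$, $u_{1,\Gamma}(T)=F$;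 $\widetilde u_{1,\Gamma}(o)=int(o)\circ Q(u_{1,\Gamma}(\partial(o)))$; and for $m\ge1$, $u_{m+1,\Gamma}(T)=(u_{1,\Gamma}(ft^m(T)),u_{m,ft^m(T)}(T))$, $\widetilde u_{m+1,\Gamma}(o)=(u_{1,\Gamma}(ft^m(\partial(o))),\widetilde u_{m,ft^m(\partial(o))}(o))$. (Note $int(T)=(int(\Gamma);u_{1,\Gamma}(T))$ for $T\in\mathcal{O}b_1(\Gamma)$.) Locally cartesian closed structure, $I_p$, $\eta_n$, $\mu_n$. A binary product structure on $\mathcal C$ is a choice of binary products $X\times Y$ with projections $pr_1,pr_2$. A locally cartesian closed structure is a choice, in each slice $\mathcal C/Z$, of binary products $(X,f)\times_Z(Y,g)$ and of internal-hom objects $\underline{Hom}_Z((X,f),(Y,g))$ with evaluation morphisms $ev:\underline{Hom}_Z((X,f),(Y,g))\times_Z(X,f)\to(Y,g)$ such that $u\mapsto(u\times_Z Id)\circ ev$ is a bijection $Mor_Z((W,h),\underline{Hom}_Z((X,f),(Y,g)))\to Mor_Z((W,h)\times_Z(X,f),(Y,g))$; for $b:(Y,g)\to(Y',g')$ over $Z$, $\underline{Hom}_Z((X,f),b)$ is the unique morphism over $Z$ with $(\underline{Hom}_Z((X,f),b)\times_Z Id)\circ ev=ev\circ b$. Set $I_p(Y)=\underline{Hom}_U((\widetilde U,p),(U\times Y,pr_1))$, with structure morphism $prI_p(Y):I_p(Y)\to U$ and evaluation $evI_p(Y):(I_p(Y),prI_p(Y))\times_U(\widetilde U,p)\to U\times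 Y$; for $f:Y\to Y'$, $I_p(f)=\underline{Hom}_U((\widetilde U,p),Id_U\times f)$. This makes $I_p$ a functor $\mathcal C\to\mathcal C$; $I_p^n$ is its $n$-th iterate. For $F:X\to U$ let $\iota_F:(X;F)\to(X,F)\times_U(\widetilde U,p)$ be the unique morphism with $\iota_F\circ pr_1=p_F$, $\iota_F\circ pr_2=Q(F)$. Set $st_p(Y)=\iota_{prI_p(Y)}\circ evI_p(Y)\circ pr_2:(I_p(Y);prI_p(Y))\to Y$. The function $Mor_{\mathcal C}(X,I_p(Y))\to D_p^1(X,Y)$, $g\mapsto(g\circ prI_p(Y),Q(g,prI_p(Y))\circ st_p(Y))$, is a bijection; $\eta_{1,Y,X}$ denotes its inverse. Bijections $\eta_{n,Y,X}:D_p^n(X,Y)\to Mor_{\mathcal C}(X,I_p^n(Y))$ are given by $\eta_{0,Y,X}=Id$ and $\eta_{n+1,Y,X}(F,a)=\eta_{1,I_p^n(Y),X}(F,\eta_{n,Y,(X;F)}(a))$; indices $Y,X$ are often omitted. Set $Id^n_Y=\eta_n^{-1}(Id_{I_p^n(Y)})\in D_p^n(I_p^n(Y),Y)$. For $n\ge1$, $\mu_{n,\Gamma}(T)=\eta_{n-1,U,int(\Gamma)}(u_{n,\Gamma}(T)):int(\Gamma)\to I_p^{n-1}(U)$ and $\widetilde\mu_{n,\Gamma}(o)=\eta_{n-1,\widetilde U,int(\Gamma)}(\widetilde u_{n,\Gamma}(o)):int(\Gamma)\to I_p^{n-1}(\widetilde U)$. Universe category functors. A universe category functor ${\bf\Phi}=(\Phi,\phi,\widetilde\phi):(\mathcal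 C,p)\to(\mathcal C',p')$ consists of a functor $\Phi:\mathcal C\to\mathcal C'$ and morphisms $\phi:\Phi(U)\to U'$, $\widetilde\phi:\Phi(\widetilde U)\to\widetilde U'$ such that $\Phi(pt)$ is final, $\Phi$ takes the chosen pullback squares of the universe $p$ to pullback squares, and the square $\widetilde\phi\circ p'=\Phi(p)\circ\phi$ is a pullback. For $F:X\to U$ let $\iota_{\bf\Phi}^{X,F}:(\Phi(X);\Phi(F)\circ\phi)\to\Phi((X;F))$ be the unique morphism (an isomorphism) with $\iota_{\bf\Phi}^{X,F}\circ\Phi(p_F)=p_{\Phi(F)\circ\phi}$ and $\iota_{\bf\Phi}^{X,F}\circ\Phi(Q(F))\circ\widetilde\phi=Q(\Phi(F)\circ\phi)$. Functions ${\bf\Phi}^n:D_p^n(X,Y)\to D_{p'}^n(\Phi(X),\Phi(Y))$ are given by ${\bf\Phi}^0(f)=\Phi(f)$ and ${\bf\Phi}^n((F,a))=(\Phi(F)\circ\phi,\iota_{\bf\Phi}^{X,F}\circ{\bf\Phi}^{n-1}(a))$ for $n\ge1$. The homomorphism $H:CC(\mathcal C,p)\to CC(\mathcal C',p')$ and the isomorphisms $\psi(\Gamma):int(H(\Gamma))\to\Phi(int(\Gamma))$: on objects $H(n,A)=(n,H_n(A))$ and $\psi(n,A)=\psi_n(A)$, where $H_0(tt)=tt$, $\psi_0(tt):pt'\to\Phi(pt)$ is the unique morphism, $H_{n+1}(A,F)=(H_n(A),\psi_n(A)\circ\Phi(F)\circ\phi)$, and $\psi_{n+1}(A,F)$ is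 the unique morphism $int(H_{n+1}(A,F))\to\Phi(int(A,F))$ with $\psi_{n+1}(A,F)\circ\Phi(Q(F))\circ\widetilde\phi=Q(\psi_n(A)\circ\Phi(F)\circ\phi)$ and $\psi_{n+1}(A,F)\circ\Phi(p_F)=p_{\psi_n(A)\circ\Phi(F)\circ\phi}\circ\psi_n(A)$. On morphisms $f:\Gamma'\to\Gamma$, $H(f):H(\Gamma')\to H(\Gamma)$ is the unique morphism with $int(H(f))=\psi(\Gamma')\circ\Phi(int(f))\circ\psi(\Gamma)^{-1}$. The morphisms $\chi$ and $\xi$. $\chi_{{\bf\Phi},n}(Y)=\eta_n({\bf\Phi}^n(Id^n_Y)):\Phi(I_p^n(Y))\to I_{p'}^n(\Phi(Y))$; $\xi_{{\bf\Phi},n}=\chi_{{\bf\Phi},n}(U)\circ I_{p'}^n(\phi):\Phi(I_p^n(U))\to I_{p'}^n(U')$; $\widetilde\xi_{{\bf\Phi},n}=\chi_{{\bf\Phi},n}(\widetilde U)\circ I_{p'}^n(\widetilde\phi):\Phi(I_p^n(\widetilde U))\to I_{p'}^n(\widetilde U')$. *)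

(* Defs.v *)
From Stdlib Require Import ProofIrrelevance Lia Arith.

Set Implicit Arguments.
Unset Strict Implicit.
Unset Printing Implicit Defensive.

(** Throughout, composition is diagrammatic: [f \; g] is "first f, then g".
    Morphisms form types compared by Leibniz equality; proof irrelevance makes
    every such type a set.  Universal properties (final objects, pullbacks,
    products, internal homs) are records carrying the universal morphism as a
    function; since that morphism is unique, this carries the same information
    as the corresponding unique-existence statement. *)

(** * Categories and functors *)

Record Category := {
  Ob :> Type;
  Hom : Ob -> Ob -> Type;
  id : forall X, Hom X X;
  comp : forall X Y Z, Hom X Y -> Hom Y Z -> Hom X Z;
  comp_id_l : forall X Y (f : Hom X Y), comp (id X) f = f;
  comp_id_r : forall X Y (f : Hom X Y), comp f (id Y) = f;
  comp_assoc : forall X Y Z W (f : Hom X Y) (g : Hom Y Z) (h : Hom Z W),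
    comp (comp f g) h = comp f (comp g h) }.

Arguments Hom {c} X Y.
Arguments id {c} X.
Arguments comp {c X Y Z} f g.

Notation "f \; g" := (comp f g) (at level 40, left associativity).

Record Functor (C D : Category) := {
  fobj :> C -> D;
  fmap : forall X Y, @Hom C X Y -> @Hom D (fobj X) (fobj Y);
  fmap_id : forall X, fmap (id X) = id (fobj X);
  fmap_comp : forall X Y Z (f : @Hom C X Y) (g : @Hom C Y Z),
    fmap (f \; g) = fmap f \; fmap g }.

Arguments fmap {C D} _ {X Y} _.

Definition idFunctor (C : Category) : Functor C C :=
  {| fobj := fun X => X; fmap := fun X Y f => f;
     fmap_id := fun X => eq_refl; fmap_comp := fun X Y Z f g => eq_refl |}.

Definition compFunctor (C D E : Category) (F : Functor C D) (G : Functor D E) :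
  Functor C E.
Proof.
refine {| fobj := fun X => G (F X); fmap := fun X Y f => fmap G (fmap F f) |}.
- abstract (intros X; rewrite !fmap_id; reflexivity).
- abstract (intros X Y Z f g; rewrite !fmap_comp; reflexivity).
Defined.

Record Iso (C : Category) (X Y : C) := {
  fwd : Hom X Y;
  bwd : Hom Y X;
  fwd_bwd : fwd \; bwd = id X;
  bwd_fwd : bwd \; fwd = id Y }.

Record IsFinal (C : Category) (T : C) := {
  bang : forall X : C, Hom X T;
  bang_uniq : forall (X : C) (f g : Hom X T), f = g }.

(** The square
<<
        P --p2--> B
        |         |
       p1         g
        v         v
        A ---f--> Z
>>
    is a pullback. *)
Record IsPullback (C : Category) (P A B Z : C)
    (p1 : Hom P A) (p2 : Hom P B) (f : Hom A Z) (g : Hom B Z) := {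
  pb_comm : p1 \; f = p2 \; g;
  pb_lift : forall (W : C) (a : Hom W A) (b : Hom W B),
    a \; f = b \; g -> Hom W P;
  pb_lift1 : forall (W : C) (a : Hom W A) (b : Hom W B) (e : a \; f = b \; g),
    pb_lift e \; p1 = a;
  pb_lift2 : forall (W : C) (a : Hom W A) (b : Hom W B) (e : a \; f = b \; g),
    pb_lift e \; p2 = b;
  pb_uniq : forall (W : C) (h k : Hom W P),
    h \; p1 = k \; p1 -> h \; p2 = k \; p2 -> h = k }.

Section Paste.
Variables (C : Category) (P A B Z B' Z' : C).
Variables (p1 : Hom P A) (p2 : Hom P B) (f : Hom A Z) (g : Hom B Z).
Variables (q : Hom B B') (z : Hom Z Z') (g' : Hom B' Z').
Hypotheses (pbl : IsPullback p1 p2 f g) (pbr : IsPullback g q z g').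

Lemma paste_eq (W : C) (a : Hom W A) (b : Hom W B') :
  a \; (f \; z) = b \; g' -> (a \; f) \; z = b \; g'.
Proof. now rewrite comp_assoc. Qed.

Lemma paste_eq2 (W : C) (a : Hom W A) (b : Hom W B')
    (e : a \; (f \; z) = b \; g') :
  a \; f = pb_lift pbr (paste_eq e) \; g.
Proof. now rewrite pb_lift1. Qed.

Definition pb_paste : IsPullback p1 (p2 \; q) (f \; z) g'.
Proof.
refine {| pb_lift := fun W a b e => pb_lift pbl (paste_eq2 e) |}.
- abstract (now rewrite <- comp_assoc, (pb_comm pbl), !comp_assoc, (pb_comm pbr)).
- abstract (intros; apply pb_lift1).
- abstract (intros; rewrite <- comp_assoc, pb_lift2; apply pb_lift2).
- abstract (intros W h k e1 e2; apply (pb_uniq pbl); [exact e1|];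
    apply (pb_uniq pbr);
    [ now rewrite !comp_assoc, <- (pb_comm pbl), <- !comp_assoc, e1
    | now rewrite !comp_assoc ]).
Defined.
End Paste.

(** * Binary products, internal homs, locally cartesian closed structures *)

Record BinProd (C : Category) := {
  prod : C -> C -> C;
  pr1 : forall X Y, Hom (prod X Y) X;
  pr2 : forall X Y, Hom (prod X Y) Y;
  pair : forall W X Y, Hom W X -> Hom W Y -> Hom W (prod X Y);
  pair_pr1 : forall W X Y (f : Hom W X) (g : Hom W Y), pair f g \; pr1 X Y = f;
  pair_pr2 : forall W X Y (f : Hom W X) (g : Hom W Y), pair f g \; pr2 X Y = g;
  pair_uniq : forall W X Y (h k : Hom W (prod X Y)),
    h \; pr1 X Y = k \; pr1 X Y -> h \; pr2 X Y = k \; pr2 X Y -> h = k }.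

Arguments prod {C} b X Y.
Arguments pr1 {C} b {X Y}.
Arguments pr2 {C} b {X Y}.
Arguments pair {C} b {W X Y} f g.

Definition prodmap (C : Category) (B : BinProd C) (X X' Y Y' : C)
    (f : Hom X X') (g : Hom Y Y') : Hom (prod B X Y) (prod B X' Y') :=
  pair B (pr1 B \; f) (pr2 B \; g).

(** [curry] is the inverse of the bijection [u |-> (u x Id) \; ev]. *)
Record InternalHoms (C : Category) (B : BinProd C) := {
  ihom : C -> C -> C;
  ev : forall X Y, Hom (prod B (ihom X Y) X) Y;
  curry : forall W X Y, Hom (prod B W X) Y -> Hom W (ihom X Y);
  curry_ev : forall W X Y (v : Hom (prod B W X) Y),
    prodmap B (curry v) (id X) \; ev X Y = v;
  ev_curry : forall W X Y (u : Hom W (ihom X Y)),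
    curry (prodmap B u (id X) \; ev X Y) = u }.

Arguments ihom {C B} i X Y.
Arguments ev {C B} i {X Y}.
Arguments curry {C B} i {W X Y} v.
Arguments curry_ev {C B} i {W X Y} v.
Arguments ev_curry {C B} i {W X Y} u.

(** The unique morphism with [prodmap (ihom_map b) id \; ev = ev \; b]. *)
Definition ihom_map (C : Category) (B : BinProd C) (E : InternalHoms B)
    (X Y Y' : C) (b : Hom Y Y') : Hom (ihom E X Y) (ihom E X Y') :=
  curry E (ev E \; b).

(** Primitive projections: [SlOb (sarr X)] is convertible to [X]. *)
#[projections(primitive)]
Record SliceOb (C : Category) (Z : C) := SlOb { sdom : C; sarr : Hom sdom Z }.
Arguments SlOb {C Z sdom} sarr.

#[projections(primitive)]
Record SliceHom (C : Category) (Z : C) (X Y : SliceOb Z) := SlHom {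
  smor : Hom (sdom X) (sdom Y);
  scomm : smor \; sarr Y = sarr X }.
Arguments SlHom {C Z X Y smor} scomm.

Lemma SliceHom_eq (C : Category) (Z : C) (X Y : SliceOb Z) (a b : SliceHom X Y) :
  smor a = smor b -> a = b.
Proof.
destruct a as [a ea], b as [b eb]; simpl; intros <-.
now rewrite (proof_irrelevance _ ea eb).
Qed.

Definition slice_id (C : Category) (Z : C) (X : SliceOb Z) : SliceHom X X :=
  SlHom (comp_id_l (sarr X)).

Definition slice_comp (C : Category) (Z : C) (X Y W : SliceOb Z)
  (a : SliceHom X Y) (b : SliceHom Y W) : SliceHom X W.
Proof.
refine (@SlHom C Z X W (smor a \; smor b) _).
abstract (now rewrite comp_assoc, !scomm).
Defined.

Definition Slice (C : Category) (Z : C) : Category.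
Proof.
refine {| Ob := SliceOb Z; Hom := @SliceHom C Z; id := @slice_id C Z;
          comp := @slice_comp C Z |}.
- abstract (intros; apply SliceHom_eq, comp_id_l).
- abstract (intros; apply SliceHom_eq, comp_id_r).
- abstract (intros; apply SliceHom_eq, comp_assoc).
Defined.

Record LCC (C : Category) := {
  lcc_prod : forall Z : C, BinProd (Slice Z);
  lcc_hom : forall Z : C, InternalHoms (lcc_prod Z) }.

Arguments lcc_prod {C} l Z.
Arguments lcc_hom {C} l Z.

(** * Universe categories *)

(** [ext F] is the vertex (X;F), [dp F] is p_F and [dQ F] is Q(F). *)
Record Universe (C : Category) := {
  U : C;
  Ut : C;
  up : Hom Ut U;
  ext : forall X : C, Hom X U -> C;
  dp : forall (X : C) (F : Hom X U), Hom (ext F) X;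
  dQ : forall (X : C) (F : Hom X U), Hom (ext F) Ut;
  ext_pb : forall (X : C) (F : Hom X U), IsPullback (dp F) (dQ F) F up }.

Record UniverseCategory := {
  ucat :> Category;
  univ : Universe ucat;
  pt : ucat;
  pt_final : IsFinal pt }.

Arguments U {C} u.
Arguments Ut {C} u.
Arguments up {C} u.
Arguments ext {C u X} F.
Arguments dp {C u X} F.
Arguments dQ {C u X} F.
Arguments ext_pb {C u X} F.

Section UniverseTheory.
Variables (C : Category) (u : Universe C).

Lemma Qmor_eq (X' X : C) (f : Hom X' X) (F : Hom X (U u)) :
  (dp (f \; F) \; f) \; F = dQ (f \; F) \; up u.
Proof. now rewrite comp_assoc, (pb_comm (ext_pb (f \; F))). Qed.

(** Q(f,F) : (X'; f F) -> (X; F). *)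
Definition Qmor (X' X : C) (f : Hom X' X) (F : Hom X (U u)) :
  Hom (ext (f \; F)) (ext F) := pb_lift (ext_pb F) (Qmor_eq f F).

Fixpoint D (n : nat) (X Y : C) : Type :=
  match n with
  | 0 => Hom X Y
  | S m => {F : Hom X (U u) & D m (ext F) Y}
  end.

Fixpoint Dpre (n : nat) (X' X Y : C) (f : Hom X' X) : D n X Y -> D n X' Y :=
  match n with
  | 0 => fun d => f \; d
  | S m => fun d =>
      existT (fun F : Hom X' (U u) => D m (ext F) Y)
        (f \; projT1 d) (Dpre (Qmor f (projT1 d)) (projT2 d))
  end.

Fixpoint Dpost (n : nat) (X Y Y' : C) (g : Hom Y Y') : D n X Y -> D n X Y' :=
  match n with
  | 0 => fun d => d \; g
  | S m => fun d =>
      existT (fun F : Hom X (U u) => D m (ext F) Y')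
        (projT1 d) (Dpost g (projT2 d))
  end.

End UniverseTheory.

(** * The C-system CC(C,p) *)

Section CSystem.
Variable C : UniverseCategory.
Let u := univ C.

(** The set Ob_n(C,p) together with the function int on it. *)
Record ObFam := { ofcar : Type; ofint : ofcar -> C }.

Fixpoint ObInt (n : nat) : ObFam :=
  match n with
  | 0 => {| ofcar := unit; ofint := fun _ => pt C |}
  | S m => {| ofcar := {A : ofcar (ObInt m) & Hom (ofint A) (U u)};
              ofint := fun AF => ext (projT2 AF) |}
  end.

Definition Obs (n : nat) : Type := ofcar (ObInt n).
Definition int_n (n : nat) (A : Obs n) : C := ofint A.

Definition CCOb : Type := {n : nat & Obs n}.
Definition int (G : CCOb) : C := int_n (projT2 G).

Definition CC : Category :=
  {| Ob := CCOb;
     Hom := fun G' G => Hom (int G') (int G);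
     id := fun G => id (int G);
     comp := fun G1 G2 G3 f g => f \; g;
     comp_id_l := fun G1 G2 f => comp_id_l f;
     comp_id_r := fun G1 G2 f => comp_id_r f;
     comp_assoc := fun G1 G2 G3 G4 f g h => comp_assoc f g h |}.

Definition intF : Functor CC C :=
  @Build_Functor CC C int (fun G' G f => f)
    (fun G => eq_refl) (fun G1 G2 G3 f g => eq_refl).

Definition len (G : CC) : nat := projT1 G.

Definition ft (T : CC) : CC :=
  match T with
  | existT _ 0 _ => existT Obs 0 tt
  | existT _ (S n) AF => existT Obs n (projT1 AF)
  end.

Definition lastmor (T : CC) : len T <> 0 -> Hom (int (ft T)) (U u) :=
  match T with
  | existT _ 0 _ => fun h => False_rect _ (h eq_refl)
  | existT _ (S n) AF => fun _ => projT2 AF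
  end.

(** p_T; it is the identity of pt at length 0. *)
Definition pT (T : CC) : @Hom CC T (ft T) :=
  match T with
  | existT _ 0 _ => id (pt C)
  | existT _ (S n) AF => dp (projT2 AF)
  end.

Record inOb (n : nat) (G T : CC) : Prop := {
  inOb_len : len T = len G + n;
  inOb_ft : Nat.iter n ft T = G }.

Definition Obn (n : nat) (G : CC) : Type := {T : CC | inOb n G T}.

Lemma len_ft (T : CC) : len (ft T) = pred (len T).
Proof. now destruct T as [[|n] A]. Qed.

Lemma len_iter_ft (m : nat) (T : CC) : len (Nat.iter m ft T) = len T - m.
Proof.
induction m as [|m IH]; simpl; [lia|].
rewrite len_ft; simpl in IH; rewrite IH; lia.
Qed.

Lemma inOb_pos (n : nat) (G T : CC) : inOb (S n) G T -> len T <> 0.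
Proof. intros [h _]; lia. Qed.

Lemma inOb_low (m : nat) (G T : CC) :
  inOb (S m) G T -> inOb 1 G (Nat.iter m ft T).
Proof.
intros [h1 h2]; split; [|exact h2].
rewrite len_iter_ft; lia.
Qed.

Lemma inOb_high (m : nat) (G T : CC) :
  inOb (S m) G T -> inOb m (Nat.iter m ft T) T.
Proof.
intros [h1 h2]; split; [|reflexivity].
rewrite len_iter_ft; lia.
Qed.

Definition u1 (G T : CC) (h : inOb 1 G T) : Hom (int G) (U u) :=
  eq_rect (ft T) (fun X => Hom (int X) (U u)) (lastmor (inOb_pos h)) G (inOb_ft h).

Lemma int_u1 (G T : CC) (h : inOb 1 G T) : int T = ext (u1 h).
Proof.
unfold u1; destruct h as [h1 h2]; simpl in *.
destruct h2; simpl.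
destruct T as [[|n] AF]; [exfalso; simpl in h1; lia|reflexivity].
Qed.

Definition castD (n : nat) (X X' Y : C) (e : X = X') (d : D u n X Y) : D u n X' Y :=
  eq_rect X (fun X => D u n X Y) d X' e.

Definition castHom (X X' Y Y' : C) (e : X = X') (e' : Y = Y') (f : Hom X Y) :
  Hom X' Y' :=
  eq_rect Y (fun Y => Hom X' Y) (eq_rect X (fun X => Hom X Y) f X' e) Y' e'.

(** u_n is only defined for n >= 1, so the index is shifted by one: [u_ n] is
    u_{n+1}, defined on Ob_{n+1}(G) with values in D^n.  The same shift applies
    to [ut_], [mu] and [mut] below. *)
Fixpoint u_ (n : nat) (G T : CC) : inOb (S n) G T -> D u n (int G) (U u) :=
  match n with
  | 0 => fun h => u1 h
  | S m => fun h =>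
      existT (fun F : Hom (int G) (U u) => D u m (ext F) (U u))
        (u1 (inOb_low h))
        (castD (int_u1 (inOb_low h)) (u_ (inOb_high h)))
  end.

Definition isSec (T : CC) (o : @Hom CC (ft T) T) : Prop := o \; pT T = id (ft T).

(** An element of \tilde Ob_n(G); its domain is ft(codom) because it is a
    section of p_{codom}. *)
Record TObn (n : nat) (G : CC) := {
  bd : Obn n G;
  omor : @Hom CC (ft (proj1_sig bd)) (proj1_sig bd);
  osec : isSec omor }.

(** int(o) \; Q(u_1(codom o)), read along ft T = G and int T = (int G; u_1 T). *)
Definition ut1 (G T : CC) (h : inOb 1 G T) (o : @Hom CC (ft T) T) :
  Hom (int G) (Ut u) :=
  castHom (f_equal int (inOb_ft h)) (int_u1 h) (fmap intF o) \; dQ (u1 h).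

Fixpoint ut_ (n : nat) (G T : CC) (o : @Hom CC (ft T) T) :
  inOb (S n) G T -> D u n (int G) (Ut u) :=
  match n with
  | 0 => fun h => ut1 h o
  | S m => fun h =>
      existT (fun F : Hom (int G) (U u) => D u m (ext F) (Ut u))
        (u1 (inOb_low h))
        (castD (int_u1 (inOb_low h)) (ut_ o (inOb_high h)))
  end.

Definition uOb (n : nat) (G : CC) (T : Obn (S n) G) : D u n (int G) (U u) :=
  u_ (proj2_sig T).

Definition utOb (n : nat) (G : CC) (o : TObn (S n) G) : D u n (int G) (Ut u) :=
  ut_ (omor o) (proj2_sig (bd o)).

End CSystem.

(** * I_p and eta_n *)

Section Ip.
Variables (C : Category) (u : Universe C) (L : LCC C) (B : BinProd C).
Let SP := lcc_prod L (U u).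
Let SE := lcc_hom L (U u).

Definition Utsl : Slice (U u) := SlOb (up u).

Definition UxY (Y : C) : Slice (U u) := SlOb (pr1 B : Hom (prod B (U u) Y) (U u)).

Definition UxYmap (Y Y' : C) (f : Hom Y Y') : @Hom (Slice (U u)) (UxY Y) (UxY Y').
Proof.
refine (@SlHom C (U u) (UxY Y) (UxY Y') (prodmap B (id (U u)) f) _).
abstract (unfold prodmap; simpl; now rewrite pair_pr1, comp_id_r).
Defined.

Definition Ipsl (Y : C) : Slice (U u) := ihom SE Utsl (UxY Y).

Definition Ip (Y : C) : C := sdom (Ipsl Y).
Definition prIp (Y : C) : Hom (Ip Y) (U u) := sarr (Ipsl Y).
Definition evIp (Y : C) : @Hom (Slice (U u)) (prod SP (Ipsl Y) Utsl) (UxY Y) := ev SE.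

Definition Ipmap (Y Y' : C) (f : Hom Y Y') : Hom (Ip Y) (Ip Y') :=
  smor (ihom_map SE Utsl (UxYmap f)).

Lemma UxYmap_id (Y : C) : UxYmap (id Y) = id (UxY Y).
Proof.
apply SliceHom_eq; simpl; unfold prodmap.
apply (pair_uniq (b := B)); rewrite ?pair_pr1, ?pair_pr2, comp_id_l; apply comp_id_r.
Qed.

Lemma UxYmap_comp (Y Y' Y'' : C) (f : Hom Y Y') (g : Hom Y' Y'') :
  UxYmap (f \; g) = UxYmap f \; UxYmap g.
Proof.
apply SliceHom_eq; simpl; unfold prodmap.
apply (pair_uniq (b := B)).
- now rewrite !comp_id_r, pair_pr1, comp_assoc, !pair_pr1.
- now rewrite pair_pr2, comp_assoc, pair_pr2, <- !comp_assoc, pair_pr2.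
Qed.

End Ip.

Lemma prodmap_comp_l (C : Category) (B : BinProd C) (X X' X'' Y : C)
    (f : Hom X X') (g : Hom X' X'') :
  prodmap B (f \; g) (id Y) = prodmap B f (id Y) \; prodmap B g (id Y).
Proof.
unfold prodmap; apply (pair_uniq (b := B)).
- now rewrite pair_pr1, comp_assoc, pair_pr1, <- !comp_assoc, pair_pr1.
- now rewrite !comp_id_r, pair_pr2, comp_assoc, !pair_pr2.
Qed.

Lemma prodmap_id (C : Category) (B : BinProd C) (X Y : C) :
  prodmap B (id X) (id Y) = id (prod B X Y).
Proof.
unfold prodmap; apply (pair_uniq (b := B));
  rewrite ?pair_pr1, ?pair_pr2, comp_id_l; apply comp_id_r.
Qed.

Section IpFunctor.
Variables (C : Category) (B : BinProd C) (E : InternalHoms B).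

Lemma curry_pre (W' W X Y : C) (f : Hom W' W) (v : Hom (prod B W X) Y) :
  f \; curry E v = curry E (prodmap B f (id X) \; v).
Proof.
rewrite <- (ev_curry E (f \; curry E v)); f_equal.
now rewrite prodmap_comp_l, comp_assoc, curry_ev.
Qed.

Lemma ihom_map_id (X Y : C) : ihom_map E X (id Y) = id (ihom E X Y).
Proof.
unfold ihom_map; rewrite <- (ev_curry E (id (ihom E X Y))).
now rewrite prodmap_id, comp_id_l, comp_id_r.
Qed.

Lemma ihom_map_comp (X Y Y' Y'' : C) (f : Hom Y Y') (g : Hom Y' Y'') :
  ihom_map E X (f \; g) = ihom_map E X f \; ihom_map E X g.
Proof.
unfold ihom_map; rewrite curry_pre; f_equal.
now rewrite <- !comp_assoc, curry_ev.
Qed.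
End IpFunctor.

Record IsBij (A B : Type) (f : A -> B) := {
  binv : B -> A;
  binv_l : forall a, binv (f a) = a;
  binv_r : forall b, f (binv b) = b }.

Section Eta.
Variables (C : Category) (u : Universe C) (L : LCC C) (B : BinProd C).
Let SP := lcc_prod L (U u).
Let SE := lcc_hom L (U u).

Definition IpF : Functor C C.
Proof.
refine {| fobj := Ip u L B; fmap := @Ipmap C u L B |}.
- abstract (intros; unfold Ipmap; now rewrite UxYmap_id, ihom_map_id).
- abstract (intros; unfold Ipmap; now rewrite UxYmap_comp, ihom_map_comp).
Defined.

Fixpoint IpnF (n : nat) : Functor C C :=
  match n with
  | 0 => idFunctor C
  | S m => compFunctor (IpnF m) IpF
  end.

Definition extsl (X : C) (F : Hom X (U u)) : Slice (U u) := SlOb (dp F \; F).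

Definition dpsl (X : C) (F : Hom X (U u)) :
  @Hom (Slice (U u)) (extsl F) (SlOb F) :=
  @SlHom C (U u) (extsl F) (SlOb F) (dp F) eq_refl.

Definition dQsl (X : C) (F : Hom X (U u)) :
  @Hom (Slice (U u)) (extsl F) (Utsl u) :=
  @SlHom C (U u) (extsl F) (Utsl u) (dQ F) (eq_sym (pb_comm (ext_pb F))).

Definition iotasl (X : C) (F : Hom X (U u)) :
  @Hom (Slice (U u)) (extsl F) (prod SP (SlOb F) (Utsl u)) :=
  pair SP (dpsl F) (dQsl F).

Definition iota (X : C) (F : Hom X (U u)) :
  Hom (ext F) (sdom (prod SP (SlOb F) (Utsl u))) := smor (iotasl F).

Notation spr1 X := (smor (pr1 SP (X := X) (Y := Utsl u))).
Notation spr2 X := (smor (pr2 SP (X := X) (Y := Utsl u))).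

Lemma iota_pr1 (X : C) (F : Hom X (U u)) : iota F \; spr1 (SlOb F) = dp F.
Proof. exact (f_equal (@smor C _ _ _) (pair_pr1 SP (dpsl F) (dQsl F))). Qed.

Lemma iota_pr2 (X : C) (F : Hom X (U u)) : iota F \; spr2 (SlOb F) = dQ F.
Proof. exact (f_equal (@smor C _ _ _) (pair_pr2 SP (dpsl F) (dQsl F))). Qed.

Lemma prodmap_spr1 (X X' : Slice (U u)) (s : Hom X X') :
  smor (prodmap SP s (id (Utsl u))) \; spr1 X' = spr1 X \; smor s.
Proof. exact (f_equal (@smor C _ _ _) (pair_pr1 SP (pr1 SP \; s) (pr2 SP \; id _))). Qed.

Lemma prodmap_spr2 (X X' : Slice (U u)) (s : Hom X X') :
  smor (prodmap SP s (id (Utsl u))) \; spr2 X' = spr2 X.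
Proof.
rewrite <- (comp_id_r (spr2 X)).
exact (f_equal (@smor C _ _ _) (pair_pr2 SP (pr1 SP \; s) (pr2 SP \; id _))).
Qed.

Definition st (Y : C) : Hom (ext (prIp u L B Y)) Y :=
  iota (prIp u L B Y) \; smor (evIp u L B Y) \; pr2 B.

(** The bijection from Mor(X, I_p(Y)) to D^1(X,Y) whose inverse is eta_1. *)
Definition toD1 (X Y : C) (g : Hom X (Ip u L B Y)) : D u 1 X Y :=
  existT (fun F : Hom X (U u) => Hom (ext F) Y)
    (g \; prIp u L B Y) (Qmor g (prIp u L B Y) \; st Y).

Lemma iota_inv_eq (X : C) (F : Hom X (U u)) :
  spr1 (SlOb F) \; F = spr2 (SlOb F) \; up u.
Proof.
exact (eq_trans (scomm (pr1 SP (X := SlOb F) (Y := Utsl u)))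
         (eq_sym (scomm (pr2 SP (X := SlOb F) (Y := Utsl u))))).
Qed.

(** The inverse of the isomorphism [iota F]. *)
Definition iota_inv (X : C) (F : Hom X (U u)) :
  Hom (sdom (prod SP (SlOb F) (Utsl u))) (ext F) :=
  pb_lift (ext_pb F) (iota_inv_eq F).

Lemma iota_iota_inv (X : C) (F : Hom X (U u)) : iota F \; iota_inv F = id (ext F).
Proof.
apply (pb_uniq (ext_pb F)); rewrite comp_assoc; unfold iota_inv;
  rewrite ?pb_lift1, ?pb_lift2, comp_id_l; [apply iota_pr1 | apply iota_pr2].
Qed.

Lemma slice_pair_uniq (X : Slice (U u)) (W : C) (h k : Hom W (sdom (prod SP X (Utsl u)))) :
  h \; spr1 X = k \; spr1 X -> h \; spr2 X = k \; spr2 X -> h = k.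
Proof.
intros e1 e2.
assert (e : h \; sarr (prod SP X (Utsl u)) = k \; sarr (prod SP X (Utsl u))).
{ rewrite <- (scomm (pr1 SP (X := X) (Y := Utsl u))), <- !comp_assoc; now rewrite e1. }
pose (W' := SlOb (k \; sarr (prod SP X (Utsl u)))).
pose (hs := @SlHom C (U u) W' (prod SP X (Utsl u)) h e).
pose (ks := @SlHom C (U u) W' (prod SP X (Utsl u)) k eq_refl).
assert (E : (hs : @Hom (Slice (U u)) _ _) = ks).
{ apply (pair_uniq (b := SP)); apply SliceHom_eq; assumption. }
exact (f_equal (@smor C _ _ _) E).
Qed.

Lemma iota_inv_iota (X : C) (F : Hom X (U u)) : iota_inv F \; iota F = id _.
Proof.
apply slice_pair_uniq; rewrite comp_assoc, comp_id_l.
- rewrite iota_pr1; apply pb_lift1.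
- rewrite iota_pr2; apply pb_lift2.
Qed.

Lemma pairU_eq (X Y : C) (F : Hom X (U u)) (a : Hom (ext F) Y) :
  pair B (iota_inv F \; dp F \; F) (iota_inv F \; a) \; pr1 B
  = sarr (prod SP (SlOb F) (Utsl u)).
Proof.
rewrite pair_pr1; unfold iota_inv; rewrite pb_lift1.
exact (scomm (pr1 SP (X := SlOb F) (Y := Utsl u))).
Qed.

Definition pairU (X Y : C) (F : Hom X (U u)) (a : Hom (ext F) Y) :
  @Hom (Slice (U u)) (prod SP (SlOb F) (Utsl u)) (UxY u B Y) :=
  @SlHom C (U u) (prod SP (SlOb F) (Utsl u)) (UxY u B Y) _ (pairU_eq a).

Definition ofD1 (X Y : C) (d : D u 1 X Y) : Hom X (Ip u L B Y) :=
  smor (curry SE (pairU (projT2 d))).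

Lemma D1_eq (X Y : C) (F F' : Hom X (U u)) (e : F = F')
    (a : Hom (ext F) Y) (a' : Hom (ext F') Y) :
  (forall W (h : Hom W (ext F)) (h' : Hom W (ext F')),
     h \; dp F = h' \; dp F' -> h \; dQ F = h' \; dQ F' -> h \; a = h' \; a') ->
  existT (fun F : Hom X (U u) => Hom (ext F) Y) F a = existT _ F' a'.
Proof.
destruct e; intros H.
rewrite <- (comp_id_l a), <- (comp_id_l a').
now rewrite (H _ (id _) (id _) eq_refl eq_refl).
Qed.

(** The transpose of [g : X -> I_p(Y)], precomposed with [iota], is the second
    component of [toD1 g]. *)
Lemma Q_st (X Y : C) (g : Hom X (Ip u L B Y)) (F : Hom X (U u))
    (e : g \; prIp u L B Y = F) (W : C) (h : Hom W (ext F))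
    (h' : Hom W (ext (g \; prIp u L B Y))) :
  h' \; dp _ = h \; dp F -> h' \; dQ _ = h \; dQ F ->
  h' \; (Qmor g (prIp u L B Y) \; st Y)
  = h \; (iota F \; (smor (prodmap SP (@SlHom C (U u) (SlOb F) (Ipsl u L B Y) g e)
                             (id (Utsl u)))
            \; (smor (evIp u L B Y) \; pr2 B))).
Proof.
intros e1 e2.
unfold st; rewrite <- !comp_assoc; f_equal; f_equal.
apply slice_pair_uniq.
- rewrite !comp_assoc, prodmap_spr1, iota_pr1, <- (comp_assoc (iota F)), iota_pr1.
  unfold Qmor; rewrite pb_lift1, <- !comp_assoc; now rewrite e1.
- rewrite !comp_assoc, prodmap_spr2, !iota_pr2.
  unfold Qmor; rewrite pb_lift2; exact e2.
Qed.

Lemma ofD1K (X Y : C) (d : D u 1 X Y) : toD1 (ofD1 d) = d.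
Proof.
destruct d as [F a].
pose (c := curry SE (pairU a)).
change (ofD1 _) with (smor c); unfold toD1.
apply (@D1_eq X Y _ _ (scomm c)).
intros W h' h e1 e2.
refine (eq_trans (@Q_st X Y (smor c) F (scomm c) W h h' e1 e2) _).
f_equal.
replace (@SlHom C (U u) (SlOb F) (Ipsl u L B Y) (smor c) (scomm c)) with c
  by now apply SliceHom_eq.
rewrite <- (comp_assoc (smor (prodmap SP c (id (Utsl u))))).
rewrite (f_equal (@smor C _ _ _) (curry_ev SE (pairU a))
  : smor (prodmap SP c (id (Utsl u))) \; smor (evIp u L B Y) = smor (pairU a)).
simpl; rewrite pair_pr2, <- comp_assoc, iota_iota_inv; apply comp_id_l.
Qed.

Lemma toD1K (X Y : C) (g : Hom X (Ip u L B Y)) : ofD1 (toD1 g) = g.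
Proof.
unfold toD1, ofD1; simpl projT2.
set (F := g \; prIp u L B Y).
pose (gs := @SlHom C (U u) (SlOb F) (Ipsl u L B Y) g eq_refl).
refine (eq_trans (f_equal (fun v => smor (curry SE v)) _)
          (f_equal (@smor C _ _ _) (ev_curry SE gs))).
apply SliceHom_eq; simpl.
apply (pair_uniq (b := B)).
- rewrite pair_pr1; unfold iota_inv; rewrite pb_lift1.
  refine (eq_trans (scomm (pr1 SP (X := SlOb F) (Y := Utsl u))) _).
  symmetry; exact (scomm (prodmap SP gs (id (Utsl u)) \; ev SE)).
- rewrite pair_pr2.
  refine (eq_trans (@Q_st X Y g F eq_refl _ (iota_inv F) (iota_inv F)
            eq_refl eq_refl) _).
  rewrite <- comp_assoc, iota_inv_iota, comp_id_l, comp_assoc; reflexivity.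
Qed.

Definition toD1_bij (X Y : C) : IsBij (@toD1 X Y) :=
  {| binv := @ofD1 X Y; binv_l := @toD1K X Y; binv_r := @ofD1K X Y |}.

Definition eta1 (X Y : C) : D u 1 X Y -> Hom X (Ip u L B Y) := binv (toD1_bij X Y).

Fixpoint eta (n : nat) (X Y : C) : D u n X Y -> Hom X (IpnF n Y) :=
  match n with
  | 0 => fun d => d
  | S m => fun d =>
      eta1 (existT (fun F : Hom X (U u) => Hom (ext F) (IpnF m Y))
              (projT1 d) (eta (projT2 d)))
  end.

Fixpoint eta_inv (n : nat) (X Y : C) : Hom X (IpnF n Y) -> D u n X Y :=
  match n with
  | 0 => fun g => g
  | S m => fun g =>
      existT (fun F : Hom X (U u) => D u m (ext F) Y)
        (projT1 (toD1 g)) (eta_inv (projT2 (toD1 g)))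
  end.

Lemma etaK (n : nat) (X Y : C) (d : D u n X Y) : eta_inv (eta d) = d.
Proof.
revert X d; induction n as [|n IH]; intros X d; [reflexivity|].
destruct d as [F a].
change (eta _) with
  (eta1 (existT (fun F : Hom X (U u) => Hom (ext F) (IpnF n Y)) F (eta a))).
cbn [eta_inv]; unfold eta1.
rewrite (binv_r (toD1_bij X (IpnF n Y))).
now cbn [projT1 projT2]; rewrite IH.
Qed.

Lemma eta_invK (n : nat) (X Y : C) (g : Hom X (IpnF n Y)) : eta (eta_inv g) = g.
Proof.
revert X g; induction n as [|n IH]; intros X g; [reflexivity|].
cbn [eta eta_inv projT1 projT2]; rewrite IH.
exact (binv_l (toD1_bij X (IpnF n Y)) g).
Qed.

Definition eta_bij (n : nat) (X Y : C) : IsBij (@eta n X Y) :=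
  {| binv := @eta_inv n X Y; binv_l := @etaK n X Y; binv_r := @eta_invK n X Y |}.

(** Id^n_Y *)
Definition Idn (n : nat) (Y : C) : D u n (IpnF n Y) Y :=
  binv (eta_bij n (IpnF n Y) Y) (id (IpnF n Y)).

End Eta.

Section Mu.
Variables (C : UniverseCategory) (L : LCC C) (B : BinProd C).

Definition mu (n : nat) (G : CC C) (T : Obn (S n) G) :
  Hom (int G) (IpnF (univ C) L B n (U (univ C))) := eta L B (uOb T).

Definition mut (n : nat) (G : CC C) (o : TObn (S n) G) :
  Hom (int G) (IpnF (univ C) L B n (Ut (univ C))) := eta L B (utOb o).

End Mu.

(** * Universe category functors *)

Record UnivCatFunctor (C C' : UniverseCategory) := {
  uF :> Functor C C';
  phi : Hom (uF (U (univ C))) (U (univ C'));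
  phit : Hom (uF (Ut (univ C))) (Ut (univ C'));
  uF_pt : IsFinal (uF (pt C));
  uF_pb : forall (X : C) (F : Hom X (U (univ C))),
    IsPullback (fmap uF (dp F)) (fmap uF (dQ F)) (fmap uF F) (fmap uF (up (univ C)));
  uF_sq : IsPullback (fmap uF (up (univ C))) phit phi (up (univ C')) }.

Section UnivCatFunctorTheory.
Variables (C C' : UniverseCategory) (P : UnivCatFunctor C C').
Let u := univ C.
Let u' := univ C'.

Definition uF_ext_pb (X : C) (F : Hom X (U u)) :
  IsPullback (fmap P (dp F)) (fmap P (dQ F) \; phit P)
    (fmap P F \; phi P) (up u') := pb_paste (uF_pb P F) (uF_sq P).

Definition iotaP (X : C) (F : Hom X (U u)) :
  Hom (ext (fmap P F \; phi P)) (P (ext F)) :=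
  pb_lift (uF_ext_pb F) (pb_comm (ext_pb (fmap P F \; phi P))).

Fixpoint PD (n : nat) (X Y : C) : D u n X Y -> D u' n (P X) (P Y) :=
  match n with
  | 0 => fun f => fmap P f
  | S m => fun d =>
      existT (fun F : Hom (P X) (U u') => D u' m (ext F) (P Y))
        (fmap P (projT1 d) \; phi P)
        (Dpre (iotaP (projT1 d)) (PD (projT2 d)))
  end.

Lemma psi_eq (X : C) (X' : C') (s : Hom X' (P X)) (F : Hom X (U u)) :
  (dp (s \; fmap P F \; phi P) \; s) \; (fmap P F \; phi P)
  = dQ (s \; fmap P F \; phi P) \; up u'.
Proof.
refine (eq_trans _ (pb_comm (ext_pb _))); now rewrite !comp_assoc.
Qed.

Lemma psi_inv_eq (X : C) (X' : C') (s : Iso X' (P X)) (F : Hom X (U u)) :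
  (fmap P (dp F) \; bwd s) \; (fwd s \; fmap P F \; phi P)
  = (fmap P (dQ F) \; phit P) \; up u'.
Proof.
refine (eq_trans _ (pb_comm (uF_ext_pb F))).
rewrite !comp_assoc, <- (comp_assoc (bwd s)).
now rewrite bwd_fwd, comp_id_l.
Qed.

(** psi_{n+1}(A,F) constructed from [s] = psi_n(A); its inverse is the
    morphism induced by [bwd s]. *)
Definition psi_step (X : C) (X' : C') (s : Iso X' (P X)) (F : Hom X (U u)) :
  Iso (ext (fwd s \; fmap P F \; phi P)) (P (ext F)).
Proof.
refine {| fwd := pb_lift (uF_ext_pb F) (psi_eq (fwd s) F);
          bwd := pb_lift (ext_pb (fwd s \; fmap P F \; phi P)) (psi_inv_eq s F) |}.
- abstract (apply (pb_uniq (ext_pb (fwd s \; fmap P F \; phi P))); rewrite comp_id_l;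
    refine (eq_trans (comp_assoc _ _ _) _);
    [ rewrite pb_lift1; refine (eq_trans (eq_sym (comp_assoc _ _ _)) _);
      rewrite pb_lift1; refine (eq_trans (comp_assoc _ _ _) _);
      now rewrite fwd_bwd, comp_id_r
    | now rewrite !pb_lift2 ]).
- abstract (apply (pb_uniq (uF_ext_pb F)); rewrite comp_id_l;
    refine (eq_trans (comp_assoc _ _ _) _);
    [ rewrite pb_lift1; refine (eq_trans (eq_sym (comp_assoc _ _ _)) _);
      rewrite pb_lift1; refine (eq_trans (comp_assoc _ _ _) _);
      now rewrite bwd_fwd, comp_id_r
    | now rewrite !pb_lift2 ]).
Defined.

Definition psi0 : Iso (pt C') (P (pt C)) :=
  {| fwd := bang (uF_pt P) (pt C');
     bwd := bang (pt_final C') (P (pt C));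
     fwd_bwd := bang_uniq (pt_final C') _ _;
     bwd_fwd := bang_uniq (uF_pt P) _ _ |}.

(** The pair (H_n(A), psi_n(A)). *)
Fixpoint Hpsi (n : nat) : forall A : Obs C n,
    {A' : Obs C' n & Iso (int_n A') (P (int_n A))} :=
  match n with
  | 0 => fun _ => existT (fun A' : Obs C' 0 => Iso (int_n A') (P (pt C))) tt psi0
  | S m => fun AF =>
      let r := Hpsi (projT1 AF) in
      existT (fun A' : Obs C' (S m) => Iso (int_n A') (P (ext (projT2 AF))))
        (existT (fun A' : Obs C' m => Hom (int_n A') (U u'))
           (projT1 r) (fwd (projT2 r) \; fmap P (projT2 AF) \; phi P))
        (psi_step (projT2 r) (projT2 AF))
  end.

Definition Hob (G : CC C) : CC C' :=
  existT (Obs C') (projT1 G) (projT1 (Hpsi (projT2 G))).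

Definition psi (G : CC C) : Iso (int (Hob G)) (P (int G)) := projT2 (Hpsi (projT2 G)).

Definition H : Functor (CC C) (CC C').
Proof.
refine (@Build_Functor (CC C) (CC C') Hob
  (fun G' G f => fwd (psi G') \; fmap P (fmap (intF C) f) \; bwd (psi G)) _ _).
- abstract (intros G; simpl; now rewrite fmap_id, comp_id_r, fwd_bwd).
- abstract (intros G1 G2 G3 f g; simpl; rewrite fmap_comp, !comp_assoc;
    now rewrite <- (comp_assoc (bwd (psi G2))), bwd_fwd, comp_id_l).
Defined.

Lemma H_ft (T : CC C) : H (ft T) = ft (H T).
Proof. now destruct T as [[|n] A]. Qed.

Lemma H_iter_ft (m : nat) (T : CC C) :
  Nat.iter m (@ft C') (H T) = H (Nat.iter m (@ft C) T).
Proof.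
induction m as [|m IH]; [reflexivity|].
change (ft (Nat.iter m (@ft C') (H T)) = H (ft (Nat.iter m (@ft C) T))).
now rewrite H_ft, IH.
Qed.

Lemma H_inOb (n : nat) (G T : CC C) : inOb n G T -> inOb n (H G) (H T).
Proof.
intros [h1 h2]; split; [exact h1|].
exact (eq_trans (H_iter_ft n T) (f_equal H h2)).
Qed.

Definition HObn (n : nat) (G : CC C) (T : Obn n G) : Obn n (H G) :=
  exist _ (H (proj1_sig T)) (H_inOb (proj2_sig T)).

(** H(o), its domain H(ft T) being rewritten as ft(H(T)). *)
Definition Hsec (T : CC C) (o : @Hom (CC C) (ft T) T) :
  @Hom (CC C') (ft (H T)) (H T) :=
  eq_rect (H (ft T)) (fun X => @Hom (CC C') X (H T)) (fmap H o) _ (H_ft T).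

Lemma Hsec_isSec (T : CC C) (o : @Hom (CC C) (ft T) T) : isSec o -> isSec (Hsec o).
Proof.
unfold Hsec, isSec; generalize (H_ft T).
destruct T as [[|n] AF]; intros e s; rewrite (proof_irrelevance _ e eq_refl);
  cbn [eq_rect].
- apply (bang_uniq (pt_final C')).
- simpl in *.
  refine (eq_trans (comp_assoc _ _ _) _); rewrite pb_lift1.
  rewrite <- comp_assoc, (comp_assoc _ (fmap P o)), <- fmap_comp.
  refine (eq_trans (f_equal (fun f => fwd _ \; fmap P f \; bwd _) s) _).
  rewrite fmap_id, comp_id_r.
  exact (fwd_bwd (psi (existT (Obs C) n (projT1 AF)))).
Qed.

Definition HTObn (n : nat) (G : CC C) (o : TObn n G) : TObn n (H G) :=
  {| bd := HObn (bd o); omor := Hsec (omor o) : @Hom (CC C') (ft (proj1_sig (HObn (bd o)))) _;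
     osec := Hsec_isSec (osec o) |}.

Variables (L : LCC C) (B : BinProd C) (L' : LCC C') (B' : BinProd C').

Definition chi (n : nat) (Y : C) :
  Hom (P (IpnF u L B n Y)) (IpnF u' L' B' n (P Y)) :=
  eta L' B' (PD (Idn u L B n Y)).

Definition xi (n : nat) : Hom (P (IpnF u L B n (U u))) (IpnF u' L' B' n (U u')) :=
  chi n (U u) \; fmap (IpnF u' L' B' n) (phi P).

Definition xit (n : nat) : Hom (P (IpnF u L B n (Ut u))) (IpnF u' L' B' n (Ut u')) :=
  chi n (Ut u) \; fmap (IpnF u' L' B' n) (phit P).

End UnivCatFunctorTheory.

(* Main.v *)
From Stdlib Require Import ProofIrrelevance Lia.
Require Import Defs.

Set Implicit Arguments.
Unset Strict Implicit.
Unset Printing Implicit Defensive.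

(** The functions [mu] and [mut] are [eta] applied to the iterated classifying
    families [u_] and [ut_], so the theorem splits into a statement about
    families and a statement about [eta].

    On families, [H] acts by [P] up to the comparison isomorphism [psi]:
    [u_ (H T)] is [PD (u_ T)], pushed forward along [phi] and pulled back along
    [psi] ([u_H], and [ut_H] for sections).  This is an induction on the length
    of the family; one step compares two morphisms into the pullback
    [P (ext F)], which have the same components ([PD_step]).

    On the other side, [eta] is natural in both variables ([eta_pre],
    [eta_post]), so it turns the pullback along [psi] and the pushforward along
    [phi] into compositions.  It remains to compute [eta (PD d)].  Since [eta]
    is a natural bijection, [IpnF n Y] represents [D n (-) Y] and every [d] is
    the pullback of the universal family [Idn] along [eta d] (Yoneda).  As [PD]
    commutes with pullback ([PD_pre]), [PD d] is the pullback of [PD Idn] along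
    [fmap P (eta d)]; applying [eta] gives [fmap P (eta d) \; chi]
    ([eta_PD]). *)

(** * Pulling back and pushing forward iterated families *)

Section Families.
Variables (C : Category) (u : Universe C).

Lemma Qmor_dp (X' X : C) (f : Hom X' X) (F : Hom X (U u)) :
  Qmor f F \; dp F = dp (f \; F) \; f.
Proof. apply pb_lift1. Qed.

Lemma Qmor_dQ (X' X : C) (f : Hom X' X) (F : Hom X (U u)) :
  Qmor f F \; dQ F = dQ (f \; F).
Proof. apply pb_lift2. Qed.

Lemma Qmor_dp_comp (X' X Y : C) (f : Hom X' X) (F : Hom X (U u)) (k : Hom X Y) :
  Qmor f F \; (dp F \; k) = dp (f \; F) \; (f \; k).
Proof. now rewrite <- !comp_assoc, Qmor_dp. Qed.

(** Equalities in [D (S n)] have second components in types depending on the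
    first.  This criterion avoids transport: the second components are
    pullbacks of one family [b] along morphisms [h], [h'] into a pullback of
    [up u], and such morphisms can be compared by their components. *)
Lemma D_pullback_eq (n : nat) (X Y Z A : C) (F F' : Hom X (U u))
    (p1 : Hom Z A) (p2 : Hom Z (Ut u)) (f : Hom A (U u))
    (pb : IsPullback p1 p2 f (up u)) (x : Hom X A) (b : D u n Z Y)
    (h : Hom (ext F) Z) (h' : Hom (ext F') Z) :
  F = F' ->
  h \; p1 = dp F \; x -> h \; p2 = dQ F ->
  h' \; p1 = dp F' \; x -> h' \; p2 = dQ F' ->
  existT (fun F : Hom X (U u) => D u n (ext F) Y) F (Dpre h b)
  = existT _ F' (Dpre h' b).
Proof.
intros <- e1 e2 e1' e2'.
replace h' with h; [reflexivity|].
apply (pb_uniq pb); congruence.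
Qed.

Lemma Dpre_comp (n : nat) (X'' X' X Y : C) (f : Hom X'' X') (g : Hom X' X)
    (d : D u n X Y) :
  Dpre (f \; g) d = Dpre f (Dpre g d).
Proof.
revert X'' X' X f g d; induction n as [|n IH]; intros X'' X' X f g d.
- apply comp_assoc.
- destruct d as [F b]; cbn [Dpre projT1 projT2].
  rewrite <- IH.
  apply (D_pullback_eq (ext_pb F) (x := f \; g)).
  + apply comp_assoc.
  + apply Qmor_dp.
  + apply Qmor_dQ.
  + now rewrite comp_assoc, Qmor_dp, Qmor_dp_comp.
  + now rewrite comp_assoc, !Qmor_dQ.
Qed.

Lemma Dpost_pre (n : nat) (X' X Y Y' : C) (f : Hom X' X) (g : Hom Y Y')
    (d : D u n X Y) :
  Dpost g (Dpre f d) = Dpre f (Dpost g d).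
Proof.
revert X' X f d; induction n as [|n IH]; intros X' X f d.
- apply comp_assoc.
- cbn [Dpre Dpost projT1 projT2]; now rewrite IH.
Qed.

End Families.

(** * Naturality of eta *)

Section EtaNatural.
Variables (C : Category) (u : Universe C) (L : LCC C) (B : BinProd C).
Let SP := lcc_prod L (U u).
Let SE := lcc_hom L (U u).

Lemma iota_inv_pre (X' X : C) (f : Hom X' X) (F : Hom X (U u)) :
  iota_inv L (f \; F) \; Qmor f F
  = smor (prodmap SP (@SlHom C (U u) (SlOb (f \; F)) (SlOb F) f eq_refl)
            (id (Utsl u))) \; iota_inv L F.
Proof.
pose (fs := @SlHom C (U u) (SlOb (f \; F)) (SlOb F) f eq_refl).
apply (pb_uniq (ext_pb F)); rewrite !comp_assoc.
- rewrite Qmor_dp, <- comp_assoc; unfold iota_inv; rewrite !pb_lift1.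
  exact (eq_sym (prodmap_spr1 L fs)).
- rewrite Qmor_dQ; unfold iota_inv; rewrite !pb_lift2.
  exact (eq_sym (prodmap_spr2 L fs)).
Qed.

(** [eta1] is currying, after [ext F] is identified with the slice product of
    [F] and [up u] by [iota].  Currying is natural, so only the naturality of
    this identification, [iota_inv_pre], has to be supplied. *)
Lemma eta1_pre (X' X Y : C) (f : Hom X' X) (d : D u 1 X Y) :
  eta1 L B (Dpre f d) = f \; eta1 L B d.
Proof.
destruct d as [F a].
pose (fs := @SlHom C (U u) (SlOb (f \; F)) (SlOb F) f eq_refl).
refine (eq_trans _ (eq_sym (f_equal (@smor C _ _ _)
  (curry_pre SE (fs : @Hom (Slice (U u)) _ _) (pairU L B a))))).
refine (f_equal (fun v => smor (curry SE v)) _).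
apply SliceHom_eq; apply (pair_uniq (b := B)).
- (* Both sides are morphisms over [U u]. *)
  refine (eq_trans (scomm (pairU L B (Qmor f F \; a))) (eq_sym _)).
  exact (scomm (prodmap SP (fs : @Hom (Slice (U u)) _ _) (id (Utsl u))
                \; pairU L B a)).
- refine (eq_trans (pair_pr2 B _ _) (eq_sym _)).
  refine (eq_trans (comp_assoc _ _ _) _).
  refine (eq_trans (f_equal (comp _) (pair_pr2 B _ _)) _).
  refine (eq_trans (eq_sym (comp_assoc _ _ _)) _).
  refine (eq_trans (f_equal (fun v => v \; a) (eq_sym (iota_inv_pre f F))) _).
  apply comp_assoc.
Qed.

(** Here the identification by [iota] does not change; [Ipmap g] is itself the
    transpose of evaluation followed by [g]. *)
Lemma eta1_post (X Y Y' : C) (g : Hom Y Y') (d : D u 1 X Y) :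
  eta1 L B (Dpost g d) = eta1 L B d \; Ipmap u L B g.
Proof.
destruct d as [F a].
refine (eq_trans _ (eq_sym (f_equal (@smor C _ _ _)
  (curry_pre SE (curry SE (pairU L B a)) (ev SE \; UxYmap u B g))))).
rewrite <- comp_assoc, curry_ev.
refine (f_equal (fun v => smor (curry SE v)) _).
apply SliceHom_eq; apply (pair_uniq (b := B)).
- refine (eq_trans (scomm (pairU L B (a \; g))) (eq_sym _)).
  exact (scomm (pairU L B a \; UxYmap u B g)).
- refine (eq_trans (pair_pr2 B _ _) (eq_sym _)).
  refine (eq_trans (comp_assoc _ _ _) _).
  refine (eq_trans (f_equal (comp _) (pair_pr2 B _ _)) _).
  refine (eq_trans (eq_sym (comp_assoc _ _ _)) _).
  refine (eq_trans (f_equal (fun v => v \; g) (pair_pr2 B _ _)) _).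
  apply comp_assoc.
Qed.

Lemma eta_pre (n : nat) (X' X Y : C) (f : Hom X' X) (d : D u n X Y) :
  eta L B (Dpre f d) = f \; eta L B d.
Proof.
revert X' X f d; induction n as [|n IH]; intros X' X f d; [reflexivity|].
cbn [Dpre eta projT1 projT2]; rewrite IH.
exact (eta1_pre f (existT (fun F : Hom X (U u) => Hom (ext F) (IpnF u L B n Y))
                     (projT1 d) (eta L B (projT2 d)))).
Qed.

Lemma eta_post (n : nat) (X Y Y' : C) (g : Hom Y Y') (d : D u n X Y) :
  eta L B (Dpost g d) = eta L B d \; fmap (IpnF u L B n) g.
Proof.
revert X d; induction n as [|n IH]; intros X d; [reflexivity|].
cbn [Dpost eta projT1 projT2]; rewrite IH.
exact (eta1_post (fmap (IpnF u L B n) g)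
         (existT (fun F : Hom X (U u) => Hom (ext F) (IpnF u L B n Y))
            (projT1 d) (eta L B (projT2 d)))).
Qed.

(** The Yoneda lemma for the representing object [IpnF n Y]. *)
Lemma D_universal (n : nat) (X Y : C) (d : D u n X Y) :
  d = Dpre (eta L B d) (Idn u L B n Y).
Proof.
rewrite <- (etaK L B (Dpre _ _)), eta_pre.
unfold Idn; rewrite (binv_r (eta_bij u L B n (IpnF u L B n Y) Y)), comp_id_r.
symmetry; apply etaK.
Qed.

End EtaNatural.

(** * The action of a universe category functor on families *)

Section Transport.
Variables (C C' : UniverseCategory) (P : UnivCatFunctor C C').
Local Notation u := (univ C).
Local Notation u' := (univ C').

Lemma iotaP_dp (X : C) (F : Hom X (U u)) :
  iotaP P F \; fmap P (dp F) = dp (fmap P F \; phi P).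
Proof. apply pb_lift1. Qed.

Lemma iotaP_dQ (X : C) (F : Hom X (U u)) :
  iotaP P F \; (fmap P (dQ F) \; phit P) = dQ (fmap P F \; phi P).
Proof. apply pb_lift2. Qed.

(** Both sides are families pulled back along morphisms into [P (ext F)], which
    is a pullback of [up u'] because [P] preserves the chosen squares and
    [fmap P (up u)] is itself a pullback of [up u']. *)
Lemma PD_pre (n : nat) (X' X Y : C) (f : Hom X' X) (d : D u n X Y) :
  PD P (Dpre f d) = Dpre (fmap P f) (PD P d).
Proof.
revert X' X f d; induction n as [|n IH]; intros X' X f d.
- apply fmap_comp.
- destruct d as [F b]; cbn [Dpre PD projT1 projT2].
  rewrite IH, <- !Dpre_comp.
  apply (D_pullback_eq (uF_ext_pb P F) (x := fmap P f)).
  + now rewrite fmap_comp, comp_assoc.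
  + rewrite comp_assoc, <- (fmap_comp P _ (dp F)), Qmor_dp, (fmap_comp P (dp _)).
    now rewrite <- (comp_assoc (iotaP P _)), iotaP_dp.
  + rewrite comp_assoc, <- (comp_assoc (fmap P _)), <- (fmap_comp P _ (dQ F)),
      Qmor_dQ.
    apply iotaP_dQ.
  + now rewrite comp_assoc, iotaP_dp, Qmor_dp.
  + now rewrite comp_assoc, iotaP_dQ, Qmor_dQ.
Qed.

(** By [D_universal] it is enough to know [eta (PD d)] for the universal
    family [d = Idn], where it is [chi] by definition. *)
Lemma eta_PD (L : LCC C) (B : BinProd C) (L' : LCC C') (B' : BinProd C')
    (n : nat) (X Y : C) (d : D u n X Y) :
  eta L' B' (PD P d) = fmap P (eta L B d) \; chi P L B L' B' n Y.
Proof. rewrite (D_universal L B d) at 1; now rewrite PD_pre, eta_pre. Qed.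

(** The inductive step shared by [u_H] and [ut_H]: the recursion defining [psi]
    agrees with the one defining [PD]. *)
Lemma PD_step (n : nat) (X Y : C) (Y' X' : C') (s : Iso X' (P X))
    (g : Hom (P Y) Y') (F : Hom X (U u)) (b : D u n (ext F) Y) :
  existT (fun F : Hom X' (U u') => D u' n (ext F) Y')
    (fwd s \; fmap P F \; phi P) (Dpre (fwd (psi_step s F)) (Dpost g (PD P b)))
  = Dpre (fwd s) (Dpost g (PD P (existT _ F b : D u (S n) X Y)) : D u' (S n) _ _).
Proof.
cbn [Dpre Dpost PD projT1 projT2].
rewrite Dpost_pre, <- Dpre_comp.
apply (D_pullback_eq (uF_ext_pb P F) (x := fwd s)).
- apply comp_assoc.
- apply pb_lift1.
- apply pb_lift2.
- now rewrite comp_assoc, iotaP_dp, Qmor_dp.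
- now rewrite comp_assoc, iotaP_dQ, Qmor_dQ.
Qed.

End Transport.

(** * The classifying families of objects and sections of the C-system *)

Section Recursion.
Variable C : UniverseCategory.
Local Notation u := (univ C).

Definition snoc (k : nat) (A : Obs C k) (F : Hom (int_n A) (U u)) : CC C :=
  existT (Obs C) (S k)
    (existT (fun A : Obs C k => Hom (int_n A) (U u)) A F).

Lemma inOb1_ind (Q : CC C -> CC C -> Prop) :
  (forall k (A : Obs C k) (F : Hom (int_n A) (U u)),
     Q (existT (Obs C) k A) (snoc F)) ->
  forall G T : CC C, inOb 1 G T -> Q G T.
Proof.
intros HQ G T [l e]; simpl in e; destruct e.
destruct T as [[|k] AF]; [exfalso; simpl in l; lia|].
destruct AF; apply HQ.
Qed.

(** The transports in [u_] and [ut_] go along equations that hold by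
    computation when the object of length one is a [snoc], so proof
    irrelevance removes them. *)
Lemma u1_snoc (k : nat) (A : Obs C k) (F : Hom (int_n A) (U u))
    (h : inOb 1 (existT (Obs C) k A) (snoc F)) :
  u1 h = F.
Proof. destruct h as [l e]; now rewrite (proof_irrelevance _ e eq_refl). Qed.

Lemma ut1_snoc (k : nat) (A : Obs C k) (F : Hom (int_n A) (U u))
    (h : inOb 1 (existT (Obs C) k A) (snoc F))
    (o : @Hom (CC C) (ft (snoc F)) (snoc F)) :
  ut1 h o = fmap (intF C) o \; dQ F.
Proof.
unfold ut1; generalize (int_u1 h); rewrite u1_snoc; intros e.
rewrite (proof_irrelevance _ (f_equal _ _) eq_refl).
now rewrite (proof_irrelevance _ e eq_refl).
Qed.

Lemma u_snoc (n k : nat) (A : Obs C k) (F : Hom (int_n A) (U u)) (T : CC C)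
    (h : inOb (S (S n)) (existT (Obs C) k A) T) (h1 : inOb (S n) (snoc F) T) :
  u_ h = existT (fun F : Hom (int_n A) (U u) => D u n (ext F) (U u)) F (u_ h1).
Proof.
change (u_ h) with
  (existT (fun F : Hom (int_n A) (U u) => D u n (ext F) (U u))
     (u1 (inOb_low h)) (castD (int_u1 (inOb_low h)) (u_ (inOb_high h)))).
generalize (inOb_low h) (inOb_high h).
rewrite (inOb_ft h1); intros l k1.
rewrite (proof_irrelevance _ k1 h1).
generalize (int_u1 l); rewrite u1_snoc; intros e.
now rewrite (proof_irrelevance _ e eq_refl).
Qed.

Lemma ut_snoc (n k : nat) (A : Obs C k) (F : Hom (int_n A) (U u)) (T : CC C)
    (o : @Hom (CC C) (ft T) T)
    (h : inOb (S (S n)) (existT (Obs C) k A) T) (h1 : inOb (S n) (snoc F) T) :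
  ut_ o h
  = existT (fun F : Hom (int_n A) (U u) => D u n (ext F) (Ut u)) F (ut_ o h1).
Proof.
change (ut_ o h) with
  (existT (fun F : Hom (int_n A) (U u) => D u n (ext F) (Ut u))
     (u1 (inOb_low h)) (castD (int_u1 (inOb_low h)) (ut_ o (inOb_high h)))).
generalize (inOb_low h) (inOb_high h).
rewrite (inOb_ft h1); intros l k1.
rewrite (proof_irrelevance _ k1 h1).
generalize (int_u1 l); rewrite u1_snoc; intros e.
now rewrite (proof_irrelevance _ e eq_refl).
Qed.

(** Peeling off the lowest step of [T] over [G] is the order of recursion of
    [u_] and [ut_]; it is opposite to that of [ObInt], which removes the top
    step, so structural induction on [T] does not apply. *)
Lemma family_ind (Q : forall n (G T : CC C), inOb (S n) G T -> Prop) :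
  (forall k (A : Obs C k) (F : Hom (int_n A) (U u)) h,
     Q 0 (existT (Obs C) k A) (snoc F) h) ->
  (forall n k (A : Obs C k) (F : Hom (int_n A) (U u)) T h1 h,
     Q n (snoc F) T h1 -> Q (S n) (existT (Obs C) k A) T h) ->
  forall n G T h, Q n G T h.
Proof.
intros Q0 QS n; induction n as [|n IH]; intros G T h.
- pose proof h as l; revert h.
  apply (inOb1_ind (Q := fun G T => forall h, Q 0 G T h)); [exact Q0 | exact l].
- cut (forall h1 : inOb (S n) (Nat.iter (S n) (@ft C) T) T, Q (S n) G T h);
    [intros c; exact (c (inOb_high h))|].
  generalize (inOb_low h); generalize (Nat.iter (S n) (@ft C) T).
  intros G1 l; revert h.
  apply (inOb1_ind (Q := fun G G1 => forall h, inOb (S n) G1 T -> Q (S n) G T h));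
    [|exact l].
  intros k A F h h1; exact (QS n k A F T h1 h (IH _ _ h1)).
Qed.

End Recursion.

(** * The homomorphism H on families *)

Section HFamilies.
Variables (C C' : UniverseCategory) (P : UnivCatFunctor C C').
Local Notation u := (univ C).

(** The equations for [psi] at [snoc F] are those of [psi_step], so peeling off
    the lowest step of [T] leaves exactly [PD_step]. *)
Lemma u_H (n : nat) (G T : CC C) (h : inOb (S n) G T)
    (h' : inOb (S n) (H P G) (H P T)) :
  u_ h' = Dpre (fwd (psi P G)) (Dpost (phi P) (PD P (u_ h))).
Proof.
revert n G T h h'.
refine (family_ind (Q := fun n G T h => forall h' : inOb (S n) (H P G) (H P T),
  u_ h' = Dpre (fwd (psi P G)) (Dpost (phi P) (PD P (u_ h)))) _ _).
- intros k A F h h'; cbn [u_ Dpre Dpost PD].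
  rewrite u1_snoc; refine (eq_trans (u1_snoc h') _).
  apply comp_assoc.
- intros n k A F T h1 h IH h'.
  rewrite (u_snoc h h1).
  refine (eq_trans (u_snoc h' (H_inOb P h1)) _).
  refine (eq_trans (f_equal (existT
    (fun F => D (univ C') n (ext F) (U (univ C')))
    (fwd (psi P (existT (Obs C) k A)) \; fmap P F \; phi P)) (IH _)) _).
  exact (PD_step (psi P (existT (Obs C) k A)) (phi P) (u_ h1)).
Qed.

Lemma ut_H (n : nat) (G T : CC C) (o : @Hom (CC C) (ft T) T)
    (h : inOb (S n) G T) (h' : inOb (S n) (H P G) (H P T)) :
  ut_ (Hsec P o) h' = Dpre (fwd (psi P G)) (Dpost (phit P) (PD P (ut_ o h))).
Proof.
revert n G T h o h'.
refine (family_ind (Q := fun n G T h => forall (o : @Hom (CC C) (ft T) T)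
  (h' : inOb (S n) (H P G) (H P T)),
  ut_ (Hsec P o) h'
  = Dpre (fwd (psi P G)) (Dpost (phit P) (PD P (ut_ o h)))) _ _).
- intros k A F h o h'; cbn [ut_ Dpre Dpost PD].
  rewrite ut1_snoc; refine (eq_trans (ut1_snoc h' (Hsec P o)) _).
  unfold Hsec; rewrite (proof_irrelevance _ (H_ft P (snoc F)) eq_refl).
  (* [H] conjugates [o] by [psi], and the inverse of [psi] at [snoc F] is a
     lift whose composite with [dQ] is known. *)
  refine (eq_trans (comp_assoc _ _ _) _).
  refine (eq_trans (f_equal (comp _) (pb_lift2 _ _)) _).
  refine (eq_trans (comp_assoc _ _ _) (f_equal (comp _) _)).
  rewrite fmap_comp; symmetry; apply comp_assoc.
- intros n k A F T h1 h IH o h'.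
  rewrite (ut_snoc o h h1).
  refine (eq_trans (ut_snoc (Hsec P o) h' (H_inOb P h1)) _).
  refine (eq_trans (f_equal (existT
    (fun F => D (univ C') n (ext F) (Ut (univ C')))
    (fwd (psi P (existT (Obs C) k A)) \; fmap P F \; phi P)) (IH o _)) _).
  exact (PD_step (psi P (existT (Obs C) k A)) (phit P) (ut_ o h1)).
Qed.

End HFamilies.

Theorem lemma3p21 (C C' : UniverseCategory)
    (L : LCC C) (B : BinProd C) (L' : LCC C') (B' : BinProd C')
    (Phi : UnivCatFunctor C C') (Gamma : CC C) (n : nat) :
  (forall T : Obn (S n) Gamma,
     mu L' B' (HObn Phi T)
     = fwd (psi Phi Gamma) \; fmap Phi (mu L B T) \; xi Phi L B L' B' n)
  /\
  (forall o : TObn (S n) Gamma,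
     mut L' B' (HTObn Phi o)
     = fwd (psi Phi Gamma) \; fmap Phi (mut L B o) \; xit Phi L B L' B' n).
Proof.
split.
- intros [T h]; unfold mu, uOb, xi; cbn [HObn proj1_sig proj2_sig].
  rewrite (u_H h), eta_pre, eta_post, (eta_PD Phi L B).
  now rewrite !comp_assoc.
- intros o; unfold mut, utOb, xit; cbn [HTObn HObn bd omor proj1_sig proj2_sig].
  rewrite (ut_H (omor o) (proj2_sig (bd o))), eta_pre, eta_post,
    (eta_PD Phi L B).
  now rewrite !comp_assoc.
Qed.
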